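(* Consider three-colored partitions whose parts are of the form $k_a$, $k_b$, $k_c$ with $k\ge1$ a positive integer and $a,b,c$ colors, ordered $1_a<1_b<1_c<2_a<2_b<2_c<3_a<\cdots$. Let $\Lambda^\star$ be the set of such partitions that contain no pair of parts of the form $j_a$ and $j_b$, no pair $j_b$ and $j_c$, and no pair $j_c$ and $(j+1)_a$ (for any $j\ge1$). For $\lambda\in\Lambda^\star$ let $|\lambda|$ be the sum of the parts ignoring color (a part $k_x$ contributes $k$), and let $\#_a(\lambda)$, $\#_c(\lambda)$ be the numbers of parts of color $a$, resp. $c$. Then $$\sum_{\lambda\in\Lambda^\star}A^{\#_a(\lambda)}C^{\#_c(\lambda)}q^{|\lambda|}=\frac{1}{(q;q)_\infty\,(Aq;q^2)_\infty\,(Cq;q^2)_\infty}.$$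
   Context: $(a;q)_\infty=\prod_{j\ge0}(1-aq^j)$. A colored partition is a finite multiset of colored parts; parts may repeat. *)

(* Defs.v *)
From HB Require Import structures.
From mathcomp Require Import all_boot all_order all_algebra.
Set Implicit Arguments. Unset Strict Implicit. Unset Printing Implicit Defensive.
Import Order.TTheory GRing.Theory Num.Theory.
Local Open Scope ring_scope.

Definition S := {poly {poly int}}.
Definition A : S := 'X.
Definition C : S := ('X : {poly int})%:P.

Definition col_a : 'I_3 := @Ordinal 3 0 isT.
Definition col_b : 'I_3 := @Ordinal 3 1 isT.
Definition col_c : 'I_3 := @Ordinal 3 2 isT.

(* A three-colored partition of size n is encoded by its multiplicity
   function: for (i, x) : 'I_n * 'I_3, m (i, x) is the number of parts
   (i+1)_x.  Any colored partition of n has parts <= n and multiplicities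
   <= n, so this type contains (exactly once) every colored partition of n. *)
Definition cpart (n : nat) := {ffun 'I_n * 'I_3 -> 'I_n.+1}.

(* multiplicity of the part k_x (k >= 1); 0 for k = 0 or k > n *)
Definition mult n (m : cpart n) (k : nat) (x : 'I_3) : nat :=
  if k is k'.+1 then oapp (fun i : 'I_n => val (m (i, x))) 0%N (insub k')
  else 0%N.

Definition weight n (m : cpart n) : nat :=
  (\sum_(p : 'I_n * 'I_3) (p.1).+1 * m p)%N.

Definition cnt n (m : cpart n) (x : 'I_3) : nat :=
  (\sum_(i : 'I_n) m (i, x))%N.

Definition LambdaStar n (m : cpart n) : bool :=
  [forall j : 'I_n.+1,
    [&& ~~ ((0 < mult m j col_a)%N && (0 < mult m j col_b)%N),
        ~~ ((0 < mult m j col_b)%N && (0 < mult m j col_c)%N) &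
        ~~ ((0 < mult m j col_c)%N && (0 < mult m j.+1 col_a)%N)]].

Definition fps := nat -> S.

Definition fps_mul (f g : fps) : fps :=
  fun n => \sum_(i < n.+1) f i * g (n - i)%N.

Definition genfun : fps :=
  fun n => \sum_(m : cpart n | LambdaStar m && (weight m == n)) A ^+ cnt m col_a * C ^+ cnt m col_c.

(* (a q^k ; q^d)_oo = prod_{j >= 0} (1 - a q^(k + d j)) as a formal power
   series (k, d >= 1): its q^n coefficient is that of the finite product over
   j <= n (the remaining factors are 1 mod q^(n+1)). *)
Definition qpoch_inf (a : S) (k d : nat) : fps :=
  fun n => (\prod_(j < n.+1) (1 - a%:P * 'X^(k + d * j)%N) : {poly S})`_n.

(* Main.v *)
Require Import Defs.
From HB Require Import structures.
From mathcomp Require Import all_boot all_order all_algebra.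
From mathcomp Require Import ring zify.
Set Implicit Arguments. Unset Strict Implicit. Unset Printing Implicit Defensive.
Import Order.TTheory GRing.Theory Num.Theory.
Local Open Scope ring_scope.

(* Let f_N be the generating function of the admissible partitions with parts
   at most N_c, and e_N that of those among them without the part N_c.  Adding
   the level N+1 gives a first order linear system for (f_N, e_N).  Clearing the
   denominator D_N = (q;q)_N (Aq;q)_N (Cq;q)_N and eliminating e_N leaves a
   second order recurrence for D_N f_N, which has the explicit solution
     D_N f_N = sum_k q^(k(2N+1)) [N+1 choose 2k]_q (q;q^2)_k (AC)^k
                 (Aq^2;q^2)_(N-k) (Cq^2;q^2)_(N-k).
   Modulo q^(N+1) only the term k = 0 survives, and cancelling the even factors
   (Aq^2;q^2)_N (Cq^2;q^2)_N against D_N gives the product.  The identity is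
   proved in this way modulo each q^(n+1). *)

(** * Gaussian binomials and the explicit solution of the recurrence *)

(** The q-Pascal rule replaces the quotient of q-factorials, so the definition makes sense in every
    commutative ring. The truncated [n' - m'] is harmless: where it truncates, the binomial next to
    it is 0. *)
Fixpoint gbinom (R : comNzRingType) (q : R) (n m : nat) : R :=
  match n, m with
  | _, 0 => 1
  | 0, _.+1 => 0
  | n'.+1, m'.+1 => gbinom q n' m'.+1 + q ^+ (n' - m') * gbinom q n' m'
  end.

Section GaussianBinomials.
Variables (R : comNzRingType) (q : R).

Lemma gbinom0 n : gbinom q n 0 = 1. Proof. by case: n. Qed.

Lemma gbinom_small n m : (n < m)%N -> gbinom q n m = 0.
Proof.
elim: n m => [|n IH] [|m] //=; rewrite ltnS => nm.
by rewrite !IH ?mulr0 ?addr0 // ltnW.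
Qed.

(** Division-free form of the ratio of neighbours in a row. *)
Lemma gbinom_right n m :
  (1 - q ^+ m.+1) * gbinom q n m.+1 = (1 - q ^+ (n - m)) * gbinom q n m.
Proof.
elim: n m => [|n IH] m; first by rewrite sub0n expr0 subrr mulr0 mul0r.
case: (leqP m n) => [mn|nm]; last first.
  by have -> : (n.+1 - m = 0)%N; [lia |
    rewrite expr0 subrr mul0r gbinom_small ?mulr0 ?ltnS // ltnW].
(* Both sides reduce to this product: Pascal's rule and the induction hypothesis apply on the left
   with [m] and on the right with [m - 1]. *)
transitivity ((1 - q ^+ n.+1) * gbinom q n m).
  rewrite [gbinom q n.+1 m.+1]/= mulrDr IH.
  have -> : n.+1 = (m.+1 + (n - m))%N by lia.
  by rewrite exprD; ring.
case: m mn => [|m] mn; first by rewrite !gbinom0 subn0.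
rewrite [gbinom q n.+1 m.+1]/= subSS mulrDr.
have -> : (1 - q ^+ (n - m)) * (q ^+ (n - m) * gbinom q n m)
        = q ^+ (n - m) * ((1 - q ^+ m.+1) * gbinom q n m.+1) by rewrite IH; ring.
have -> : n.+1 = (m.+1 + (n - m))%N by lia.
by rewrite exprD; ring.
Qed.

Lemma gbinom_top n m :
  (1 - q ^+ n.+1) * gbinom q n m = (1 - q ^+ (n.+1 - m)) * gbinom q n.+1 m.
Proof.
case: m => [|m]; first by rewrite !gbinom0 subn0.
case: (leqP m n) => [mn|nm]; last first.
  by rewrite (@gbinom_small n) 1?ltnW // gbinom_small // !mulr0.
rewrite [gbinom q n.+1 m.+1]/= subSS mulrDr.
have -> : (1 - q ^+ (n - m)) * (q ^+ (n - m) * gbinom q n m)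
        = q ^+ (n - m) * ((1 - q ^+ m.+1) * gbinom q n m.+1)
  by rewrite gbinom_right; ring.
have -> : n.+1 = (m.+1 + (n - m))%N by lia.
by rewrite exprD; ring.
Qed.

End GaussianBinomials.

Section ExplicitSolution.
Variables (R : comNzRingType) (q a c : R).

Definition evenprod (j : nat) : R :=
  \prod_(i < j) ((1 - a * q ^+ (2 * i.+1)) * (1 - c * q ^+ (2 * i.+1))).

Definition odd_poch (k : nat) : R := \prod_(i < k) (1 - q ^+ (2 * i).+1).

Definition numer_coef (N k : nat) : R :=
  q ^+ (k * (2 * N).+1) * gbinom q N.+1 (2 * k) * odd_poch k.

Definition numer (N : nat) : R :=
  \sum_(k < N.+1) numer_coef N k * (a * c) ^+ k * evenprod (N - k).

Lemma evenprodS j : evenprod j.+1 =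
  evenprod j * ((1 - a * q ^+ (2 * j.+1)) * (1 - c * q ^+ (2 * j.+1))).
Proof. by rewrite /evenprod big_ord_recr. Qed.

Lemma odd_pochS k : odd_poch k.+1 = odd_poch k * (1 - q ^+ (2 * k).+1).
Proof. by rewrite /odd_poch big_ord_recr. Qed.

Lemma numer_coef_small N k : (N.+1 < 2 * k)%N -> numer_coef N k = 0.
Proof. by move=> h; rewrite /numer_coef gbinom_small // mulr0 mul0r. Qed.

(** The binomial kills every added term, whatever the truncated [N - k] gives. This lets the three
    sums of the recurrence share their range. *)
Lemma numer_widen N K : (N < K)%N ->
  numer N = \sum_(k < K) numer_coef N k * (a * c) ^+ k * evenprod (N - k).
Proof.
move=> NK; rewrite /numer.
rewrite (big_ord_widen _ (fun k => numer_coef N k * (a * c) ^+ k * evenprod (N - k)) NK).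
rewrite big_mkcond; apply: eq_bigr => k _; case: ifPn => // kN.
by rewrite numer_coef_small ?mul0r //; lia.
Qed.

Lemma numer_coef_top N k :
  (1 - q ^+ N.+2) * q ^+ (2 * N + 2 * k + 3) * numer_coef N k
  = (1 - q ^+ (N.+2 - 2 * k)) * q ^+ (2 * N + 3) * numer_coef N.+1 k.
Proof.
rewrite /numer_coef.
transitivity (q ^+ (k * (2 * N).+1 + (2 * N + 2 * k + 3)) * odd_poch k *
   ((1 - q ^+ N.+2) * gbinom q N.+1 (2 * k))); first by rewrite (exprD q (k * _)); ring.
rewrite gbinom_top.
have -> : (k * (2 * N).+1 + (2 * N + 2 * k + 3) = (2 * N + 3) + k * (2 * N.+1).+1)%N by lia.
by rewrite (exprD q (2 * N + 3)); ring.
Qed.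

Lemma numer_coef_step N k :
  (1 - q ^+ N.+2) * q ^+ (2 * N + 2 * k + 3) * (1 - q ^+ (N.+1 - 2 * k)) * numer_coef N k
  = (1 - q ^+ (2 * k.+1)) * numer_coef N.+1 k.+1.
Proof.
rewrite mulrAC numer_coef_top /numer_coef odd_pochS.
have -> : (2 * k.+1 = (2 * k).+2)%N by lia.
transitivity (q ^+ (k.+1 * (2 * N.+1).+1) * odd_poch k * (1 - q ^+ (2 * k).+1)
  * ((1 - q ^+ (2 * k).+2) * gbinom q N.+2 (2 * k).+2)); last by ring.
rewrite gbinom_right subSS.
transitivity (q ^+ (k.+1 * (2 * N.+1).+1) * odd_poch k * (1 - q ^+ (N.+1 - 2 * k))
  * ((1 - q ^+ (2 * k).+1) * gbinom q N.+2 (2 * k).+1)); last by ring.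
rewrite gbinom_right.
have -> : (k.+1 * (2 * N.+1).+1 = (2 * N + 3) + k * (2 * N.+1).+1)%N by lia.
by rewrite (exprD q (2 * N + 3)); ring.
Qed.

(** Raising [N] multiplies the power of q by [q ^+ (2 * k.+1)], so the difference keeps only the
    second term of Pascal's rule; the last factor of [odd_poch k.+1] then lowers the index of that
    binomial to [2 * k]. *)
Lemma numer_coef_pascal N k :
  numer_coef N.+2 k.+1 - q ^+ (2 * k.+1) * numer_coef N.+1 k.+1
  = q ^+ (3 * N + 6) * (1 - q ^+ (N.+2 - 2 * k)) * numer_coef N.+1 k.
Proof.
case: (ltnP N.+2 (2 * k)) => [h|h].
  by rewrite !numer_coef_small ?mulr0 ?subr0 //; lia.
have e2 : (2 * k.+1 = (2 * k).+2)%N by lia.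
have gS : gbinom q N.+3 (2 * k).+2 = gbinom q N.+2 (2 * k).+2
  + q ^+ (N.+2 - (2 * k).+1) * gbinom q N.+2 (2 * k).+1 by [].
rewrite /numer_coef odd_pochS e2 gS.
have e3 : (k.+1 * (2 * N.+2).+1 = (2 * k).+2 + k.+1 * (2 * N.+1).+1)%N by lia.
transitivity (q ^+ (k.+1 * (2 * N.+2).+1) * q ^+ (N.+2 - (2 * k).+1)
   * odd_poch k * ((1 - q ^+ (2 * k).+1) * gbinom q N.+2 (2 * k).+1)).
  by rewrite e3 (exprD q (2 * k).+2); ring.
rewrite gbinom_right.
(* At [2 * k = N.+2] the subtraction in the exponent truncates, but a factor [1 - q ^+ 0]
   vanishes. *)
move: h; rewrite leq_eqVlt => /orP[/eqP h|h].
  by rewrite h subnn expr0 subrr !(mul0r, mulr0).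
have e4 : (k.+1 * (2 * N.+2).+1 + (N.+2 - (2 * k).+1)
   = (3 * N + 6) + k * (2 * N.+1).+1)%N by lia.
by rewrite -exprD e4 (exprD q (3 * N + 6)); ring.
Qed.

Definition numer_rec1 N : R := 1 - (a + c) * q ^+ (2 * N + 4) - a * c * q ^+ (2 * N + 3)
  + a * c * (q ^+ (3 * N + 6) + q ^+ (3 * N + 5)).

Definition numer_rec0 N : R := a * c * q ^+ (3 * N + 4) * (1 - q ^+ N.+2)
  * ((1 - a * q ^+ N.+1) * (1 - c * q ^+ N.+1)).

Let term N k := numer_coef N k * (a * c) ^+ k * evenprod (N - k).

(* Telescoping certificate: the summands of the recurrence for numer match up to
   cert N k - cert N k.+1. *)
Let cert N k := numer_coef N.+1 k * (1 - q ^+ (2 * k)) * (a * c) ^+ k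
  * (evenprod (N.+1 - k) - q ^+ (3 * N + 5 - 2 * k) * (a * c) * evenprod (N.+1 - k)).

(** The remainder besides the certificate is put over [numer_coef N.+1 k], so that it cancels
    against its negative in [numer_rec1_term]. What survives there, with [q ^+ (3 * N + 6)], is the
    right side of [numer_coef_pascal]. *)
Lemma numer_rec0_term N k : numer_rec0 N * term N k = - cert N k.+1
  + (1 - q ^+ (N.+2 - 2 * k)) * q ^+ (2 * N + 3) * numer_coef N.+1 k
    * (a * c) ^+ k.+1 * evenprod (N.+1 - k).
Proof.
case: (ltnP N.+1 (2 * k)) => [h|h].
  rewrite /term /cert (numer_coef_small h) (@numer_coef_small N.+1 k.+1); last by lia.
  rewrite !(mul0r, mulr0) oppr0 add0r.
  case: (ltnP N.+2 (2 * k)) => [h'|h']; first by rewrite (numer_coef_small h') !(mulr0, mul0r).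
  have -> : (N.+2 - 2 * k = 0)%N by lia.
  by rewrite expr0 subrr !(mulr0, mul0r).
have kN : (k <= N)%N by lia.
rewrite /cert /term subSS -numer_coef_top exprS (subSn kN) evenprodS.
have -> : numer_coef N.+1 k.+1 * (1 - q ^+ (2 * k.+1)) =
  (1 - q ^+ N.+2) * q ^+ (2 * N + 2 * k + 3) * (1 - q ^+ (N.+1 - 2 * k)) * numer_coef N k.
  by rewrite numer_coef_step mulrC.
rewrite /numer_rec0; set r := (N.+1 - 2 * k)%N.
(* With [N.+1 = 2 * k + r], every power of q becomes a monomial in q, [q ^+ k] and [q ^+ r], which
   leaves a polynomial identity. *)
have -> : q ^+ N.+1 = q ^+ k ^+ 2 * q ^+ r by rewrite -exprM -exprD; congr (_ ^+ _); lia.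
have -> : q ^+ (2 * (N - k).+1) = q ^+ k ^+ 2 * q ^+ r ^+ 2
  by rewrite -!exprM -exprD; congr (_ ^+ _); lia.
have -> : q ^+ (3 * N + 5 - 2 * k.+1) = q ^+ k ^+ 4 * q ^+ r ^+ 3
  by rewrite -!exprM -exprD; congr (_ ^+ _); lia.
have -> : q ^+ (3 * N + 4) = q * q ^+ k ^+ 6 * q ^+ r ^+ 3
  by rewrite -!exprM -exprS -exprD; congr (_ ^+ _); lia.
have -> : q ^+ (2 * N + 2 * k + 3) = q * q ^+ k ^+ 6 * q ^+ r ^+ 2
  by rewrite -!exprM -exprS -exprD; congr (_ ^+ _); lia.
ring.
Qed.

Lemma numer_rec1_term N k : numer_rec1 N * term N.+1 k = cert N k
  + q ^+ (2 * k) * numer_coef N.+1 k * (a * c) ^+ k * evenprod (N.+2 - k)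
  + (q ^+ (3 * N + 6) * (1 - q ^+ (N.+2 - 2 * k))
     - (1 - q ^+ (N.+2 - 2 * k)) * q ^+ (2 * N + 3)) * numer_coef N.+1 k
    * (a * c) ^+ k.+1 * evenprod (N.+1 - k).
Proof.
case: (ltnP N.+2 (2 * k)) => [h|h].
  by rewrite /term /cert (numer_coef_small h) !(mul0r, mulr0) !addr0.
have kN : (k <= N.+1)%N by lia.
rewrite /term /cert exprS (subSn kN) evenprodS /numer_rec1; set r := (N.+2 - 2 * k)%N.
have -> : q ^+ (2 * k) = q ^+ k ^+ 2 by rewrite -exprM mulnC.
have -> : q ^+ (2 * (N.+1 - k).+1) = q ^+ k ^+ 2 * q ^+ r ^+ 2
  by rewrite -!exprM -exprD; congr (_ ^+ _); lia.
have -> : q ^+ (2 * N + 4) = q ^+ k ^+ 4 * q ^+ r ^+ 2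
  by rewrite -!exprM -exprD; congr (_ ^+ _); lia.
have -> : q ^+ (3 * N + 6) = q ^+ k ^+ 6 * q ^+ r ^+ 3
  by rewrite -!exprM -exprD; congr (_ ^+ _); lia.
have e : q ^+ (3 * N + 5) = q ^+ k ^+ 2 * q ^+ (3 * N + 5 - 2 * k)
  by rewrite -!exprM -exprD; congr (_ ^+ _); lia.
have e2 : q ^+ (2 * N + 3) * q ^+ r = q ^+ (3 * N + 5 - 2 * k)
  by rewrite -!exprD; congr (_ ^+ _); lia.
rewrite e -e2.
ring.
Qed.

Lemma numer_rec N : numer N.+2 = numer_rec1 N * numer N.+1 + numer_rec0 N * numer N.
Proof.
rewrite (@numer_widen N.+2 N.+4) // (@numer_widen N.+1 N.+3) // (@numer_widen N N.+3); last by lia.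
rewrite !mulr_sumr -big_split /=.
under [RHS]eq_bigr => k _ do rewrite -/(term N.+1 k) -/(term N k) numer_rec1_term numer_rec0_term.
have cert0 : cert N 0 = 0 by rewrite /cert muln0 expr0 subrr mulr0 !mul0r.
have certN : cert N N.+3 = 0 by rewrite /cert numer_coef_small ?mul0r //; lia.
(* The certificate telescopes to 0. In the second sum the terms from [numer_coef N.+1] also
   telescope, down to their [k = 0] term, which equals the [k = 0] term of [numer N.+2]. *)
transitivity (\sum_(k < N.+3) (cert N k - cert N k.+1)
  + \sum_(k < N.+3) (q ^+ (2 * k) * numer_coef N.+1 k * (a * c) ^+ k * evenprod (N.+2 - k)
     + (numer_coef N.+2 k.+1 - q ^+ (2 * k.+1) * numer_coef N.+1 k.+1)
        * (a * c) ^+ k.+1 * evenprod (N.+2 - k.+1))); last first.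
  by rewrite -big_split; apply: eq_bigr => k _ /=; rewrite numer_coef_pascal subSS; ring.
rewrite -(big_mkord xpredT (fun k => cert N k - cert N k.+1)).
under [X in _ = X + _]eq_bigr => k _ do rewrite -opprB.
rewrite sumrN telescope_sumr // cert0 certN subrr oppr0 add0r.
rewrite big_ord_recl /= big_split /= [X in _ = X + _]big_ord_recl /=.
under [X in _ = _ + X]eq_bigr => k _ do rewrite !mulrBl.
rewrite sumrB [X in _ - X]big_ord_recr /= (@numer_coef_small N.+1 N.+3); last by lia.
rewrite mulr0 !mul0r addr0 muln0 expr0 mul1r -!addrA; congr (_ + _).
by rewrite [RHS]addrC subrK.
Qed.

End ExplicitSolution.

(** * Transfer matrix *)

Section TransferMatrix.
Variables (R : comNzRingType) (M : nat) (w : nat -> 'I_3 -> R).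

(** The bound [M] on multiplicities is separate from the number [N] of levels, so that induction on
    [N] is possible; [cpart n] is the case [N = M = n]. *)
Definition config (N : nat) := {ffun 'I_N * 'I_3 -> 'I_M.+1}.

(* Levels start at 1, as for [mult]. *)
Definition level N (g : config N) (k : nat) (x : 'I_3) : nat :=
  if k is k'.+1 then oapp (fun i : 'I_N => val (g (i, x))) 0%N (insub k')
  else 0%N.

Definition no_clash (m : nat -> 'I_3 -> nat) (j : nat) : bool :=
  [&& ~~ ((0 < m j col_a)%N && (0 < m j col_b)%N),
      ~~ ((0 < m j col_b)%N && (0 < m j col_c)%N) &
      ~~ ((0 < m j col_c)%N && (0 < m j.+1 col_a)%N)].

Definition admissible N (g : config N) : bool :=
  [forall j : 'I_N.+1, no_clash (level g) j].

Definition wt N (g : config N) : R := \prod_(p : 'I_N * 'I_3) w p.1 p.2 ^+ g p.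

Definition gf N : R := \sum_(g : config N) (admissible g)%:R * wt g.

Definition gf_no_c N : R :=
  \sum_(g : config N) (admissible g && (level g N col_c == 0%N))%:R * wt g.

Definition triple : Type := ('I_M.+1 * 'I_M.+1 * 'I_M.+1)%type.

Definition pick3 (l : triple) (x : 'I_3) : 'I_M.+1 :=
  if val x == 0%N then l.1.1 else if val x == 1%N then l.1.2 else l.2.

Definition extend N (p : config N * triple) : config N.+1 :=
  [ffun i => if insub (val i.1) is Some j then p.1 (j, i.2) else pick3 p.2 i.2].

Definition restrict N (g : config N.+1) : config N * triple :=
  ([ffun i => g (widen_ord (leqnSn N) i.1, i.2)],
   (g (ord_max, col_a), g (ord_max, col_b), g (ord_max, col_c))).

Lemma ord3P (x : 'I_3) : [\/ x = col_a, x = col_b | x = col_c].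
Proof.
by case: x => -[|[|[|//]]] h; [apply: Or31|apply: Or32|apply: Or33]; apply: val_inj.
Qed.

Lemma restrictK N : cancel (@restrict N) (@extend N).
Proof.
move=> g; apply/ffunP => -[i x]; rewrite ffunE /=.
case: insubP => [j _ ji|]; first by rewrite ffunE /=; congr (g (_, _)); apply: val_inj.
rewrite -leqNgt => Ni; have -> : i = ord_max by apply: val_inj => /=; have := ltn_ord i; lia.
by case: (ord3P x) => ->.
Qed.

Lemma extendK N : cancel (@extend N) (@restrict N).
Proof.
move=> [g [[a b] c]]; rewrite /restrict; congr (_, (_, _, _)).
- apply/ffunP => -[i x]; rewrite !ffunE /=.
  by case: insubP => [j _ ji|]; [congr (g (_, _)); apply: val_inj | rewrite ltn_ord].
- by rewrite ffunE /=; case: insubP => [j|] //=; rewrite ltnn.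
- by rewrite ffunE /=; case: insubP => [j|] //=; rewrite ltnn.
- by rewrite ffunE /=; case: insubP => [j|] //=; rewrite ltnn.
Qed.

Lemma level_extend N (g : config N) l k x :
  level (extend (g, l)) k x = if k == N.+1 then val (pick3 l x) else level g k x.
Proof.
case: k => [|k] //=; rewrite eqSS.
case: insubP => [i _ ik|] /=.
  rewrite ffunE /=; case: insubP => [j _ ji|].
    have jk : val j = k by exact: etrans ji ik.
    have kN : (k < N)%N by rewrite -jk; apply: ltn_ord.
    by rewrite (ltn_eqF kN) insubT /=; congr (val (g (_, _))); apply: val_inj.
  have kN : (k <= N)%N by rewrite -ltnS -ik; apply: ltn_ord.
  by rewrite -leqNgt [nat_of_ord i]ik => Nk; rewrite eqn_leq kN Nk.
rewrite -leqNgt => Nk; rewrite insubN -?leqNgt 1?ltnW //.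
by case: eqP Nk => // ->; rewrite ltnn.
Qed.

Lemma level_out N (g : config N) k x : (N < k)%N -> level g k x = 0%N.
Proof. by case: k => [|k] //=; rewrite ltnS => h; rewrite insubN // -leqNgt. Qed.

Lemma forall_ordS (P : pred nat) n :
  [forall j : 'I_n.+1, P j] = [forall j : 'I_n, P j] && P n.
Proof.
apply/forallP/andP => [h | [/forallP h hn] j].
  split; last exact: (h ord_max).
  by apply/forallP => j; have := h (widen_ord (leqnSn n) j).
have := ltn_ord j; rewrite ltnS leq_eqVlt => /orP[/eqP -> // | jn].
exact: (h (Ordinal jn)).
Qed.

(** The condition at [N] gains the clash of N_c with (N+1)_a. The one at [N.+1] concerns only the
    new level, since level [N.+2] is empty. *)
Lemma admissible_extend N (g : config N) l :
  admissible (extend (g, l)) =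
  admissible g && [&& ~~ ((0 < level g N col_c)%N && (0 < l.1.1)%N),
    ~~ ((0 < l.1.1)%N && (0 < l.1.2)%N) & ~~ ((0 < l.1.2)%N && (0 < l.2)%N)].
Proof.
rewrite /admissible !forall_ordS.
have -> : [forall j : 'I_N, no_clash (level (extend (g, l))) j]
        = [forall j : 'I_N, no_clash (level g) j].
  apply: eq_forallb => j; rewrite /no_clash !level_extend.
  by rewrite eqSS !(ltn_eqF (ltn_ord j)) ltn_eqF // ltnS ltnW.
rewrite /no_clash !level_extend !eqxx (ltn_eqF (ltnSn N)) (gtn_eqF (ltnSn N.+1)).
rewrite (@level_out _ _ N.+2) // (@level_out _ _ N.+1) //= !andbF /= !andbT.
by rewrite -!andbA; do !bool_congr.
Qed.

Lemma wt_levels N (g : config N) : wt g = \prod_(i < N) \prod_x w i x ^+ g (i, x).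
Proof. by rewrite pair_bigA; apply: eq_bigr => -[]. Qed.

Lemma wt_extend N (g : config N) l :
  wt (extend (g, l)) = wt g * (w N col_a ^+ l.1.1 * w N col_b ^+ l.1.2 * w N col_c ^+ l.2).
Proof.
rewrite !wt_levels big_ord_recr /=; congr (_ * _).
  apply: eq_bigr => i _; apply: eq_bigr => x _; rewrite ffunE /=.
  by case: insubP => [j _ ji|]; [congr (_ ^+ val (g (_, _))); apply: val_inj | rewrite ltn_ord].
have e x : extend (g, l) (ord_max, x) = pick3 l x.
  by rewrite ffunE /=; case: insubP => [j|] //=; rewrite ltnn.
rewrite !big_ord_recr big_ord0 /= mul1r !e.
by congr (_ ^+ _ * _ ^+ _ * _ ^+ _); congr (w _ _); apply: val_inj.
Qed.

(** The total weight of one to [M] copies of the part (N+1)_x. *)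
Definition pos_sum N x : R := \sum_(i < M) w N x ^+ i.+1.

Lemma sum_split (F : bool -> R) N x :
  \sum_(i < M.+1) F (0 < i)%N * w N x ^+ i = F false + F true * pos_sum N x.
Proof. by rewrite big_ord_recl /= expr0 mulr1 mulr_sumr. Qed.

(** Admissibility sees only which multiplicities are positive, so the sum over a level collapses to
    eight Boolean patterns. *)
Lemma sum_triple (F : bool -> bool -> bool -> R) N :
  \sum_(l : triple) F (0 < l.1.1)%N (0 < l.1.2)%N (0 < l.2)%N
     * (w N col_a ^+ l.1.1 * w N col_b ^+ l.1.2 * w N col_c ^+ l.2)
  = (F false false false + F false false true * pos_sum N col_c)
    + (F false true false + F false true true * pos_sum N col_c) * pos_sum N col_b
    + ((F true false false + F true false true * pos_sum N col_c)
       + (F true true false + F true true true * pos_sum N col_c) * pos_sum N col_b)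
      * pos_sum N col_a.
Proof.
pose S2 x y := F x y false + F x y true * pos_sum N col_c.
pose S1 x := S2 x false + S2 x true * pos_sum N col_b.
rewrite -[RHS](sum_split S1).
rewrite -(pair_bigA _ (fun (p : 'I_M.+1 * 'I_M.+1) (k : 'I_M.+1) =>
   F (0 < p.1)%N (0 < p.2)%N (0 < k)%N
   * (w N col_a ^+ p.1 * w N col_b ^+ p.2 * w N col_c ^+ k))) /=.
rewrite -(pair_bigA _ (fun i j : 'I_M.+1 => \sum_(k < M.+1) F (0 < i)%N (0 < j)%N (0 < k)%N
   * (w N col_a ^+ i * w N col_b ^+ j * w N col_c ^+ k))) /=.
apply: eq_bigr => i _; rewrite /S1 -(sum_split (S2 _)) mulr_suml.
apply: eq_bigr => j _; rewrite /S2 -(sum_split (F _ _)) !mulr_suml.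
by apply: eq_bigr => k _; ring.
Qed.

Lemma sum_extend N (F : config N.+1 -> R) :
  \sum_g F g = \sum_g \sum_l F (extend (g, l)).
Proof.
rewrite pair_bigA (reindex (@extend N)) /=; last first.
  by apply: onW_bij; exists (@restrict N); [exact: extendK | exact: restrictK].
by apply: eq_bigr => -[].
Qed.

(** The new level may be empty or use the colors b, c, a, or a with c; the last two patterns require
    that N_c be absent. *)
Lemma gfS N : gf N.+1 = (1 + pos_sum N col_b + pos_sum N col_c) * gf N
  + pos_sum N col_a * (1 + pos_sum N col_c) * gf_no_c N.
Proof.
rewrite /gf sum_extend /gf_no_c !mulr_sumr -big_split; apply: eq_bigr => g _ /=.
pose z := (0 < level g N col_c)%N.
rewrite eqn0Ngt -/z; transitivity ((admissible g)%:R * wt g * \sum_(l : triple)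
   [&& ~~ (z && (0 < l.1.1)%N), ~~ ((0 < l.1.1)%N && (0 < l.1.2)%N)
     & ~~ ((0 < l.1.2)%N && (0 < l.2)%N)]%:R
   * (w N col_a ^+ l.1.1 * w N col_b ^+ l.1.2 * w N col_c ^+ l.2)).
  rewrite mulr_sumr; apply: eq_bigr => l _.
  by rewrite admissible_extend wt_extend -mulnb natrM -/z; ring.
rewrite (sum_triple (fun x y v => [&& ~~ (z && x), ~~ (x && y) & ~~ (y && v)]%:R)) /=.
by case: (admissible g); case: z => /=; ring.
Qed.

Lemma gf_no_cS N :
  gf_no_c N.+1 = (1 + pos_sum N col_b) * gf N + pos_sum N col_a * gf_no_c N.
Proof.
rewrite /gf_no_c sum_extend /gf !mulr_sumr -big_split; apply: eq_bigr => g _; cbv beta.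
pose z := (0 < level g N col_c)%N.
rewrite eqn0Ngt -/z; transitivity ((admissible g)%:R * wt g * \sum_(l : triple)
   [&& ~~ (z && (0 < l.1.1)%N), ~~ ((0 < l.1.1)%N && (0 < l.1.2)%N),
     ~~ ((0 < l.1.2)%N && (0 < l.2)%N) & ~~ (0 < l.2)%N]%:R
   * (w N col_a ^+ l.1.1 * w N col_b ^+ l.1.2 * w N col_c ^+ l.2)).
  rewrite mulr_sumr; apply: eq_bigr => l _.
  rewrite admissible_extend wt_extend level_extend eqxx eqn0Ngt.
  by rewrite -!andbA -mulnb natrM -/z; ring.
rewrite (sum_triple (fun x y v => [&& ~~ (z && x), ~~ (x && y), ~~ (y && v) & ~~ v]%:R)) /=.
by case: (admissible g); case: z => /=; ring.
Qed.

Lemma gf0 : gf 0 = 1 /\ gf_no_c 0 = 1.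
Proof.
have e (F : config 0 -> R) : \sum_g F g = F [ffun=> ord0].
  rewrite (bigD1 [ffun=> ord0]) //= big1 ?addr0 // => g /eqP []; apply/ffunP => -[[]] //.
have wt1 (g : config 0) : wt g = 1 by rewrite wt_levels big_ord0.
have adm (g : config 0) : admissible g.
  by apply/forallP => j; rewrite /no_clash ord1 /=.
by rewrite /gf /gf_no_c !e wt1 adm !mulr1.
Qed.

End TransferMatrix.

(** * The product formula when q is nilpotent *)

Section NilpotentBase.
Variables (R : comNzRingType) (q a c : R) (n : nat).
Hypothesis q_nil : q ^+ n.+1 = 0.

Lemma expr_nil z k : (z * q ^+ k.+1) ^+ n.+1 = 0.
Proof. by rewrite exprMn -exprM mulnC exprM q_nil expr0n /= mulr0. Qed.

(** The factor is a unit: its inverse is a geometric sum, finite by nilpotency. *)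
Lemma cancel_1sub z k u v :
  (1 - z * q ^+ k.+1) * u = (1 - z * q ^+ k.+1) * v -> u = v.
Proof.
move=> e; have inv := subrX1 (z * q ^+ k.+1) n.+1.
set s := \sum_(i < n.+1) _ in inv; rewrite expr_nil in inv.
have {}inv : 1 = s * (1 - z * q ^+ k.+1).
  by apply: oppr_inj; rewrite -sub0r inv; ring.
by rewrite -[u]mul1r -[v]mul1r inv -!mulrA e.
Qed.

Lemma cancel_evenprod N u v : evenprod q a c N * u = evenprod q a c N * v -> u = v.
Proof.
elim: N u v => [|N IH] u v; first by rewrite /evenprod big_ord0 !mul1r.
rewrite evenprodS -!mulrA => /IH.
have -> : (2 * N.+1 = (2 * N).+2)%N by lia.
by move=> /cancel_1sub /cancel_1sub.
Qed.

Definition color_wt (x : 'I_3) : R :=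
  if x == col_a then a else if x == col_b then 1 else c.

Definition part_wt (k : nat) (x : 'I_3) : R := color_wt x * q ^+ k.+1.

(** The cap [n] on multiplicities loses nothing, because the power [n.+1] of [part_wt k x] is 0. *)
Lemma geometric k x :
  (1 - part_wt k x) * pos_sum n part_wt k x = part_wt k x.
Proof.
have inv := subrX1 (part_wt k x) n.+1.
rewrite {1}/part_wt expr_nil big_ord_recl expr0 in inv.
have e : pos_sum n part_wt k x = \sum_(i < n) part_wt k x ^+ lift ord0 i by [].
rewrite -e in inv.
have -> : (1 - part_wt k x) * pos_sum n part_wt k x
  = - ((part_wt k x - 1) * (1 + pos_sum n part_wt k x)) + (part_wt k x - 1) by ring.
by rewrite -inv; ring.
Qed.

Definition denom N : R := \prod_(i < N)
  ((1 - q ^+ i.+1) * (1 - a * q ^+ i.+1) * (1 - c * q ^+ i.+1)).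

Lemma denomS N : denom N.+1 =
  denom N * ((1 - q ^+ N.+1) * (1 - a * q ^+ N.+1) * (1 - c * q ^+ N.+1)).
Proof. by rewrite /denom big_ord_recr. Qed.

Local Notation f := (gf n part_wt).
Local Notation e := (gf_no_c n part_wt).

Lemma denom_gfS N : let x := q ^+ N.+1 in
  denom N.+1 * f N.+1
    = (1 - a * x) * (1 - c * x ^+ 2) * (denom N * f N)
      + a * x * (1 - x) * (denom N * e N).
Proof.
move=> x; have ha := geometric N col_a; have hb := geometric N col_b.
have hc := geometric N col_c.
rewrite gfS denomS -/x.
rewrite {1 3}/part_wt /color_wt /= -/x in ha.
rewrite {1 3}/part_wt /color_wt /= mul1r -/x in hb.
rewrite {1 3}/part_wt /color_wt /= -/x in hc.
move: ha hb hc; set ua := pos_sum _ _ _ col_a; set ub := pos_sum _ _ _ col_b.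
set uc := pos_sum _ _ _ col_c => ha hb hc.
(* Each [pos_sum] is paired with the factor of [denom N.+1] that clears it. *)
transitivity ((1 - a * x) * ((1 - x) * (1 - c * x) + (1 - c * x) * ((1 - x) * ub)
     + (1 - x) * ((1 - c * x) * uc)) * (denom N * f N)
  + (1 - x) * ((1 - a * x) * ua) * (1 - c * x + (1 - c * x) * uc) * (denom N * e N)).
  by ring.
by rewrite ha hb hc; ring.
Qed.

Lemma denom_gf_no_cS N : let x := q ^+ N.+1 in
  denom N.+1 * e N.+1
    = (1 - a * x) * (1 - c * x) * (denom N * f N)
      + a * x * (1 - x) * (1 - c * x) * (denom N * e N).
Proof.
move=> x; have ha := geometric N col_a; have hb := geometric N col_b.
rewrite gf_no_cS denomS -/x.
rewrite {1 3}/part_wt /color_wt /= -/x in ha.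
rewrite {1 3}/part_wt /color_wt /= mul1r -/x in hb.
move: ha hb; set ua := pos_sum _ _ _ col_a; set ub := pos_sum _ _ _ col_b => ha hb.
transitivity ((1 - a * x) * (1 - c * x) * (1 - x + (1 - x) * ub) * (denom N * f N)
  + (1 - x) * (1 - c * x) * ((1 - a * x) * ua) * (denom N * e N)).
  by ring.
by rewrite ha hb; ring.
Qed.

Lemma numer_at0 : numer q a c 0 = 1.
Proof. by rewrite /numer big_ord1 /numer_coef /odd_poch /evenprod !big_ord0 /= !mulr1. Qed.

Lemma numer_at1 : numer q a c 1 = (1 - a * q) * (1 - c * q ^+ 2) + a * q * (1 - q).
Proof.
rewrite /numer !big_ord_recr big_ord0 /numer_coef /odd_poch /evenprod /=.
by rewrite !big_ord_recr !big_ord0 /=; ring.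
Qed.

(** Subtracting [1 - c * x] times [denom_gfS] from [denom_gf_no_cS] eliminates [e N], whence the
    second formula. Inserting it into [denom_gfS] one level higher gives the recurrence
    [numer_rec]. *)
Lemma denom_gf_no_c N : let x := q ^+ N.+1 in
  denom N.+1 * f N.+1 = numer q a c N.+1 /\
  denom N.+1 * e N.+1 = (1 - c * x) * numer q a c N.+1
    + c * x ^+ 2 * (1 - a * x) * (1 - c * x) * numer q a c N.
Proof.
elim: N => [|N [IHf IHe]] x.
  rewrite denom_gfS denom_gf_no_cS /denom big_ord0.
  have [-> ->] := gf0 n part_wt.
  by rewrite numer_at0 numer_at1 /x !expr1; split; ring.
rewrite (denom_gfS N.+1) (denom_gf_no_cS N.+1) IHf IHe -/x numer_rec /numer_rec1 /numer_rec0.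
have xE : x = q * q ^+ N.+1 by rewrite /x exprS.
have -> : q ^+ N.+2 = q * q ^+ N.+1 by rewrite exprS.
rewrite xE; set y := q ^+ N.+1.
have -> : q ^+ (2 * N + 4) = q ^+ 2 * y ^+ 2
  by rewrite -exprM -exprD; congr (_ ^+ _); lia.
have -> : q ^+ (2 * N + 3) = q * y ^+ 2
  by rewrite -exprM -exprS; congr (_ ^+ _); lia.
have -> : q ^+ (3 * N + 6) = q ^+ 3 * y ^+ 3
  by rewrite -exprM -exprD; congr (_ ^+ _); lia.
have -> : q ^+ (3 * N + 5) = q ^+ 2 * y ^+ 3
  by rewrite -exprM -exprD; congr (_ ^+ _); lia.
have -> : q ^+ (3 * N + 4) = q * y ^+ 3
  by rewrite -exprM -exprS; congr (_ ^+ _); lia.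
by split; ring.
Qed.

Lemma denom_gf N : denom N * f N = numer q a c N.
Proof.
case: N => [|N]; last by case: (denom_gf_no_c N).
by rewrite /denom big_ord0 mul1r numer_at0 (gf0 n part_wt).1.
Qed.

Lemma expr_large k : (n < k)%N -> q ^+ k = 0.
Proof. by move=> h; rewrite -(subnK h) exprD q_nil mulr0. Qed.

(** The terms with [k] positive contain a power of q of exponent at least [2 * n + 1]. *)
Lemma numer_nil : numer q a c n = evenprod q a c n.
Proof.
rewrite /numer big_ord_recl big1 ?addr0 /=.
  by rewrite /numer_coef muln0 gbinom0 mul0n /odd_poch big_ord0 subn0 !mul1r.
by move=> k _; rewrite /numer_coef expr_large ?mul0r // /bump /=; lia.
Qed.

Definition oddprod z : R := \prod_(j < n.+1) (1 - z * q ^+ (1 + 2 * j)).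

Lemma prod_widen z m : (n <= m)%N ->
  \prod_(i < m) (1 - z * q ^+ i.+1) = \prod_(i < n) (1 - z * q ^+ i.+1).
Proof.
move=> nm; rewrite (big_ord_widen m (fun i => 1 - z * q ^+ i.+1) nm).
rewrite [RHS]big_mkcond; apply: eq_bigr => i _; case: ifPn => //.
by rewrite -leqNgt => ni; rewrite expr_large // mulr0 subr0.
Qed.

Lemma prod_odd_even z m :
  \prod_(j < m.+1) (1 - z * q ^+ (1 + 2 * j)) * \prod_(i < m) (1 - z * q ^+ (2 * i.+1))
  = \prod_(i < (2 * m).+1) (1 - z * q ^+ i.+1).
Proof.
elim: m => [|m IH]; first by rewrite !big_ord_recr !big_ord0 /= !mulr1.
have e : (2 * m.+1 = (2 * m).+2)%N by lia.
rewrite big_ord_recr [\prod_(i < m.+1) _]big_ord_recr /= mulrACA IH e.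
by rewrite [RHS]big_ord_recr [\prod_(i < (2 * m).+2) _]big_ord_recr /= add1n; ring.
Qed.

Lemma oddprod_even z :
  oddprod z * \prod_(i < n) (1 - z * q ^+ (2 * i.+1)) = \prod_(i < n) (1 - z * q ^+ i.+1).
Proof. by rewrite prod_odd_even prod_widen //; lia. Qed.

(** Multiplication by [evenprod q a c n] completes the odd products, so the left side becomes
    [denom n * f n]. By [denom_gf] and [numer_nil] this is [evenprod q a c n], which can be
    cancelled. *)
Theorem gf_nil : f n * ((\prod_(j < n.+1) (1 - 1 * q ^+ (1 + 1 * j)))
   * (oddprod a * oddprod c)) = 1.
Proof.
apply: (@cancel_evenprod n); rewrite mulr1 -[in RHS]numer_nil -denom_gf /denom !big_split /=.
rewrite -!oddprod_even /evenprod big_split /=.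
have -> : \prod_(j < n.+1) (1 - 1 * q ^+ (1 + 1 * j)) = \prod_(i < n) (1 - q ^+ i.+1).
  transitivity (\prod_(j < n.+1) (1 - 1 * q ^+ j.+1)).
    by apply: eq_bigr => j _; rewrite mul1n.
  by rewrite prod_widen //; apply: eq_bigr => j _; rewrite mul1r.
by ring.
Qed.

End NilpotentBase.

(** * Truncated power series *)

Local Notation trunc m := (in_qpoly ('X^(m.+1))).

Section Truncation.
Variable T : comNzRingType.
Implicit Types p r : {poly T}.

Lemma coef_in_qpolyXn m p i : (i < m.+1)%N ->
  (trunc m p : {poly T})`_i = p`_i.
Proof.
move=> im; rewrite /= mk_monic_Xn /=.
rewrite [in RHS](@Pdiv.RingMonic.rdivp_eq _ ('X^(m.+1)) (monicXn _ _) p).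
by rewrite coefD coefMXn im add0r.
Qed.

Lemma in_qpolyXnP m p r :
  trunc m p = trunc m r <-> (forall i, (i < m.+1)%N -> p`_i = r`_i).
Proof.
split=> [e i im | e].
  by rewrite -(coef_in_qpolyXn p im) e coef_in_qpolyXn.
apply: val_inj; apply/polyP => i; case: (ltnP i m.+1) => im.
  by have := e i im; rewrite -(coef_in_qpolyXn p im) -(coef_in_qpolyXn r im).
have sz s : (size (trunc m s : {poly T}) <= i)%N.
  apply: leq_trans im; rewrite -ltnS.
  by apply: (leq_trans (size_mk_monic _)); rewrite mk_monic_Xn size_polyXn.
by rewrite (nth_default _ (sz p)) (nth_default _ (sz r)).
Qed.

(** This supplies the hypothesis [q_nil] in the quotient by ['X^(m.+1)]. *)
Lemma in_qpolyXn_nil m : trunc m ('X : {poly T}) ^+ m.+1 = 0.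
Proof.
rewrite -rmorphXn -(rmorph0 (trunc m)); apply/in_qpolyXnP => i im.
by rewrite coefXn coef0 ltn_eqF.
Qed.

End Truncation.

Lemma rmorph_gf (R R' : comNzRingType) (h : {rmorphism R -> R'}) M
    (w : nat -> 'I_3 -> R) N :
  h (gf M w N) = gf M (fun k x => h (w k x)) N.
Proof.
rewrite rmorph_sum; apply: eq_bigr => g _; rewrite rmorphM rmorph_nat; congr (_ * _).
by rewrite rmorph_prod; apply: eq_bigr => p _; rewrite rmorphXn.
Qed.

Lemma eq_gf (R : comNzRingType) M (w w' : nat -> 'I_3 -> R) N :
  (forall k x, w k x = w' k x) -> gf M w N = gf M w' N.
Proof.
move=> ww; apply: eq_bigr => g _; congr (_ * _).
by apply: eq_bigr => p _; rewrite ww.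
Qed.

(** * From truncations to the generating function *)

Definition genpoly n : {poly Defs.S} := gf n (part_wt 'X A%:P C%:P) n.

Definition qpoch_poly (z : Defs.S) k d n : {poly Defs.S} :=
  \prod_(j < n.+1) (1 - z%:P * 'X^(k + d * j)).

Definition denom_poly n : {poly Defs.S} :=
  qpoch_poly 1 1 1 n * (qpoch_poly A 1 2 n * qpoch_poly C 1 2 n).

Lemma genpoly_denom n : trunc n (genpoly n * denom_poly n) = 1.
Proof.
have qn := in_qpolyXn_nil Defs.S n.
rewrite -(gf_nil (trunc n A%:P) (trunc n C%:P) qn).
rewrite /denom_poly !rmorphM /=; congr (_ * (_ * (_ * _))).
- rewrite rmorph_gf; apply: eq_gf => k x.
  rewrite /part_wt rmorphM rmorphXn /color_wt /=.
  by case: (x == col_a) => //; case: (x == col_b); rewrite ?rmorph1.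
- rewrite rmorph_prod; apply: eq_bigr => j _.
  by rewrite rmorphB rmorphM rmorphXn polyC1 rmorph1.
- rewrite rmorph_prod; apply: eq_bigr => j _.
  by rewrite rmorphB rmorph1 rmorphM rmorphXn.
- rewrite rmorph_prod; apply: eq_bigr => j _.
  by rewrite rmorphB rmorph1 rmorphM rmorphXn.
Qed.

Lemma coef_qpoch_poly z k d m n i : (0 < k)%N -> (0 < d)%N ->
  (m <= n)%N -> (i < m.+1)%N -> (qpoch_poly z k d n)`_i = (qpoch_poly z k d m)`_i.
Proof.
move=> k0 d0 mn im; rewrite -(subnK mn); elim: (n - m)%N => // r IH.
rewrite addSn /qpoch_poly big_ord_recr /= mulrBr mulr1 coefB IH mulrCA coefCM coefMXn.
have -> : (i < k + d * (r + m).+1)%N.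
  apply: (leq_trans im); rewrite -addn1 addnC leq_add //.
  by rewrite (leq_trans _ (leq_pmull _ d0)) // leqW ?leq_addl.
by rewrite mulr0 subr0.
Qed.

(** No partitions are compared: modulo ['X^(m.+1)] both polynomials are inverse to [denom_poly m],
    and inverses are unique. *)
Lemma coef_genpoly m n i : (m <= n)%N -> (i < m.+1)%N -> (genpoly n)`_i = (genpoly m)`_i.
Proof.
move=> mn; move: i; apply/in_qpolyXnP.
have en : trunc m (genpoly n * denom_poly m) = 1.
  transitivity (trunc m (genpoly n * denom_poly n)).
    rewrite !rmorphM /=; congr (_ * (_ * (_ * _)));
      by apply/in_qpolyXnP => i im; rewrite (@coef_qpoch_poly _ _ _ m n).
  rewrite -(rmorph1 (trunc m)); apply/in_qpolyXnP => i im.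
  apply: (iffLR (in_qpolyXnP n _ _)); last by apply: leq_trans im _.
  by rewrite genpoly_denom rmorph1.
rewrite -[LHS]mulr1 -(genpoly_denom m) -[RHS]mul1r -en !rmorphM /=; ring.
Qed.

Lemma wt_monomial n (m : config n n) :
  wt (part_wt 'X A%:P C%:P) m
  = (A ^+ cnt m col_a * C ^+ cnt m col_c)%:P * 'X^(weight m).
Proof.
transitivity (\prod_(p : 'I_n * 'I_3) (color_wt A%:P C%:P p.2 ^+ m p * 'X^(p.1.+1 * m p))).
  by apply: eq_bigr => p _; rewrite /part_wt exprMn -exprM.
rewrite big_split prodrXr /=; congr (_ * _).
transitivity (\prod_i \prod_x color_wt A%:P C%:P x ^+ m (i, x)).
  by rewrite pair_bigA; apply: eq_bigr => -[].
rewrite polyCM !polyC_exp /cnt -!prodrXr -big_split; apply: eq_bigr => i _ /=.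
rewrite !big_ord_recr big_ord0 /= mul1r /color_wt /= expr1n mulr1.
by congr (_ ^+ m (_, _) * _ ^+ m (_, _)); apply: val_inj.
Qed.

Lemma coef_genpoly_diag n : (genpoly n)`_n = genfun n.
Proof.
rewrite /genpoly /gf coef_sum /genfun [RHS]big_mkcond; apply: eq_bigr => m _.
rewrite wt_monomial mulr_natl coefMn coefCM coefXn eq_sym.
(* With [N = M = n] the two predicates agree by unfolding. *)
have -> : admissible m = LambdaStar m by [].
by case: (LambdaStar m); case: eqP => _; rewrite ?mulr1 ?mulr0 ?mul0rn.
Qed.

Lemma fps_mul_coef (f g : fps) (p r : {poly Defs.S}) n :
  (forall i, (i <= n)%N -> f i = p`_i) -> (forall i, (i <= n)%N -> g i = r`_i) ->
  fps_mul f g n = (p * r)`_n.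
Proof.
move=> fp gr; rewrite coefM; apply: eq_bigr => i _.
by rewrite fp ?gr ?leq_subr // -ltnS.
Qed.

(* sum_{lambda in Lambda^*} A^{#a} C^{#c} q^{|lambda|}
     = 1 / ((q;q)_oo (Aq;q^2)_oo (Cq;q^2)_oo),
   stated as: LHS * (q;q)_oo (Aq;q^2)_oo (Cq;q^2)_oo = 1 in Z[A,C][[q]]. *)
Theorem theorem3p2 :
  forall n : nat,
    fps_mul genfun
      (fps_mul (qpoch_inf 1 1 1) (fps_mul (qpoch_inf A 1 2) (qpoch_inf C 1 2))) n
    = (n == 0%N)%:R.
Proof.
move=> n; transitivity (genpoly n * denom_poly n)`_n.
  have poch z k d m i : (0 < k)%N -> (0 < d)%N -> (i <= m)%N -> (m <= n)%N ->
      qpoch_inf z k d i = (qpoch_poly z k d n)`_i.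
    by move=> k0 d0 im mn; rewrite (@coef_qpoch_poly _ _ _ i) // (leq_trans im).
  apply: fps_mul_coef => [i i_n | i i_n].
    (* [genfun i] is read off [genpoly i]; stability of coefficients carries it to [genpoly n]. *)
    by rewrite (@coef_genpoly i) // coef_genpoly_diag.
  apply: fps_mul_coef => [j ji | j ji]; first by rewrite (poch _ _ _ i).
  by apply: fps_mul_coef => [l lj | l lj]; rewrite (poch _ _ _ j) // (leq_trans ji).
rewrite -coef1 -[X in _ = X](coef_in_qpolyXn _ (ltnSn n)) rmorph1 -(genpoly_denom n).
by rewrite coef_in_qpolyXn.
Qed.
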